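(* Let $R$ be a (Krasner) hyperring and let $M$ be a nonzero (right) $R$-hypermodule. Then $M$ is simple if and only if $M=mR$ for every nonzero $m\in M$, where $mR=\{mr\mid r\in R\}$.
   Context: For a nonempty set $H$, $\mathcal P^*(H)$ is the set of nonempty subsets of $H$. A canonical hypergroup $(H,+,0)$ is a nonempty set $H$ with a hyperoperation $+\colon H\times H\to\mathcal P^*(H)$ and $0\in H$ (with $A+B=\bigcup_{a\in A,b\in B}(a+b)$ for subsets, and elements identified with singletons) such that for all $a,b,c\in H$: $a+b=b+a$; $a+(b+c)=(a+b)+c$; $a+0=\{a\}$; there is a unique $-a\in H$ with $0\in a-a:=a+(-a)$; and $a\in b+c$ implies $c\in -b+a$ and $b\in a-c$. A (Krasner) hyperring $R$ is a canonical hypergroup $(R,+,0)$ with an associative binary (single-valued) multiplication such that $a0=0a=0$, $a(b+c)=ab+ac$, $(a+b)c=ac+bc$; a multiplicative identity and commutativity are not assumed. A subhypergroup is a nonempty subset $S$ with $x-y\subseteq S$ for all $x,y\in S$. A (right) $R$-hypermodule is a canonical hypergroup $M$ with a map $M\times R\to M$, $(m,r)\mapsto mr$, such that $(m+m')r=mr+m'r$, $m(r+r')=mr+mr'$, $m(rr')=(mr)r'$, $m0=0$. A subhypermodule is a subhypergroup $S$ of $M$ with $sr\in S$ for all $s\in S$, $r\in R$. $M$ is simple if $MR\neq 0$ (i.e. $mr\ne0$ for some $m\in M,r\in R$) and its only subhypermodules are $0$ and $M$. *)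

(* Defs.v *)
From HB Require Import structures.
From mathcomp Require Import all_boot.
From mathcomp Require Import boolp classical_sets.

Set Implicit Arguments.
Unset Strict Implicit.
Unset Printing Implicit Defensive.

Local Open Scope classical_set_scope.

Declare Scope hyper_scope.
Delimit Scope hyper_scope with hyper.
Local Open Scope hyper_scope.

Definition set_hop (H : Type) (op : H -> H -> set H) (A B : set H) : set H :=
  \bigcup_(a in A) \bigcup_(b in B) op a b.

(* The inverse is carried as a function; haddrN and hopp_unique say that
   [hopp a] is the unique b with 0 in a + b. *)
HB.mixin Record isCanonicalHypergroup (H : Type) := {
  hzero : H;
  hopp : H -> H;
  hadd : H -> H -> set H;
  hadd_neq0 : forall a b, hadd a b !=set0;
  haddC : forall a b, hadd a b = hadd b a;
  haddA : forall a b c,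
    set_hop hadd [set a] (hadd b c) = set_hop hadd (hadd a b) [set c];
  haddr0 : forall a, hadd a hzero = [set a];
  haddrN : forall a, hadd a (hopp a) hzero;
  hopp_unique : forall a b, hadd a b hzero -> b = hopp a;
  hadd_reversible : forall a b c,
    hadd b c a -> hadd (hopp b) a c /\ hadd a (hopp c) b
}.

#[short(type="canonicalHypergroupType")]
HB.structure Definition CanonicalHypergroup := {H of isCanonicalHypergroup H}.

Arguments hzero {s}.

Notation "0" := hzero : hyper_scope.
Notation "- x" := (hopp x) : hyper_scope.
Notation "x + y" := (hadd x y) : hyper_scope.
Notation "x - y" := (hadd x (hopp y)) : hyper_scope.

HB.mixin Record CanonicalHypergroup_isHyperring R
    of CanonicalHypergroup R := {
  hmul : R -> R -> R;
  hmulA : forall a b c, hmul a (hmul b c) = hmul (hmul a b) c;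
  hmulr0 : forall a, hmul a 0 = 0;
  hmul0r : forall a, hmul 0 a = 0;
  hmulDr : forall a b c : R,
    [set hmul a x | x in b + c] = hmul a b + hmul a c;
  hmulDl : forall a b c : R,
    [set hmul x c | x in a + b] = hmul a c + hmul b c
}.

#[short(type="hyperringType")]
HB.structure Definition Hyperring :=
  {R of CanonicalHypergroup R & CanonicalHypergroup_isHyperring R}.

Notation "x * y" := (hmul x y) : hyper_scope.

HB.mixin Record CanonicalHypergroup_isHypermodule (R : hyperringType) M
    of CanonicalHypergroup M := {
  hact : M -> R -> M;
  hactDl : forall (m m' : M) (r : R),
    [set hact x r | x in m + m'] = hact m r + hact m' r;
  hactDr : forall (m : M) (r r' : R),
    [set hact m x | x in r + r'] = hact m r + hact m r';
  hactA : forall (m : M) (r r' : R), hact m (r * r') = hact (hact m r) r';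
  hactr0 : forall m : M, hact m 0 = 0
}.

#[short(type="hypermoduleType")]
HB.structure Definition Hypermodule (R : hyperringType) :=
  {M of CanonicalHypergroup M & CanonicalHypergroup_isHypermodule R M}.

Definition subhypergroup (H : canonicalHypergroupType) (S : set H) : Prop :=
  S !=set0 /\ forall x y, S x -> S y -> x - y `<=` S.

Definition subhypermodule (R : hyperringType) (M : hypermoduleType R)
    (S : set M) : Prop :=
  subhypergroup S /\ forall (s : M) (r : R), S s -> S (hact s r).

Definition simple (R : hyperringType) (M : hypermoduleType R) : Prop :=
  (exists (m : M) (r : R), hact m r <> 0) /\
  forall S : set M, subhypermodule S -> S = [set 0] \/ S = [set: M].

(* Main.v *)
(* For m <> 0 the set mR is a subhypermodule, and so is the annihilator
   {x | xR = 0}.  If M is simple then the annihilator is not M, hence is 0, so mR is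
   nonzero and must be M.  Conversely, a subhypermodule containing some s <> 0
   contains sR = M, and m itself lies in mR, so MR <> 0. *)
Require Import Defs.
From HB Require Import structures.
From mathcomp Require Import all_boot.
From mathcomp Require Import boolp classical_sets.

Local Open Scope classical_set_scope.
Local Open Scope hyper_scope.

Lemma hopp0 (H : canonicalHypergroupType) : - (0 : H) = 0.
Proof. by apply/esym/hopp_unique; rewrite haddr0. Qed.

Section HypermoduleTheory.
Context {R : hyperringType} {M : hypermoduleType R}.
Implicit Types (m x : M) (r : R).

(** The axioms give only [hact m 0 = 0]; writing the zero of [M] as [hact 0 0] moves [r] next to the
    zero of [R], which absorbs it. *)
Lemma hact0r r : hact (0 : M) r = 0.
Proof. by rewrite -{1}(hactr0 (0 : M)) -hactA hmul0r hactr0. Qed.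

Lemma hactrN m r : hact m (- r) = - hact m r.
Proof.
apply: hopp_unique; rewrite -hactDr.
by exists 0; [exact: haddrN | exact: hactr0].
Qed.

Lemma hactNr m r : hact (- m) r = - hact m r.
Proof.
apply: hopp_unique; rewrite -hactDl.
by exists 0; [exact: haddrN | exact: hact0r].
Qed.

Lemma subhypermodule_orbit m : subhypermodule [set hact m r | r in [set: R]].
Proof.
split; first split.
- by exists (hact m 0), 0.
(* As sets, mr - mr' = m(r - r'), so each element of the difference is some [hact m s]. *)
- move=> _ _ [r _ <-] [r' _ <-]; rewrite -hactrN -hactDr.
  by move=> _ [s _ <-]; exists s.
- by move=> _ r [s _ <-]; exists (s * r) => //; rewrite hactA.
Qed.

Lemma subhypermodule_ann :
  subhypermodule [set x : M | forall r, hact x r = 0].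
Proof.
split; first split.
- by exists 0 => r; exact: hact0r.
- move=> x y x0 y0 z xyz r.
  (* zr lies in (x - y)r = xr - yr = 0 - 0, which is the singleton of 0. *)
  have : [set hact u r | u in x - y] (hact z r) by exists z.
  by rewrite hactDl hactNr x0 y0 hopp0 haddr0.
- by move=> x r x0 r'; rewrite -hactA.
Qed.

End HypermoduleTheory.

Theorem proposition3p3 (R : hyperringType) (M : hypermoduleType R)
    (hM : [set: M] <> [set 0]) :
  simple M <->
  forall m : M, m <> 0 -> [set: M] = [set hact m r | r in [set: R]].
Proof.
split=> [[[x [r xr0]] Msimple] m m0 | orbitT].
  have [mR0|-> //] := Msimple _ (subhypermodule_orbit m).
  have annm r' : hact m r' = 0.
    suff : [set (0 : M)] (hact m r') by [].
    by rewrite -mR0; exists r'.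
  (* Both alternatives are absurd: the annihilator contains the nonzero [m], but not [x], as xr is
     nonzero. *)
  have [ann0|annT] := Msimple _ subhypermodule_ann.
    case: m0; suff : [set (0 : M)] m by [].
    by rewrite -ann0.
  case: xr0; suff : [set y : M | forall r, hact y r = 0] x by apply.
  by rewrite annT.
have nonzero_of (S : set M) : S !=set0 -> S <> [set 0] ->
    exists2 s, S s & s <> 0.
  move=> [s Ss] S0; apply: contrapT => noS; apply: S0.
  have S0 t : S t -> t = 0 by move=> St; apply: contrapT => t0; apply: noS; exists t.
  (* Nonemptiness puts 0 in [S]: its witness [s] is itself 0. *)
  by apply/seteqP; split=> [t /S0 //|t ->]; rewrite -(S0 s Ss).
split.
  have [|m _ m0] := nonzero_of _ _ hM; first by exists 0.
  (* Membership of [m] in mR gives [r] with mr = m, a nonzero product. *)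
  have : [set: M] m by [].
  by rewrite (orbitT m m0) => -[r _ mr]; exists m, r; rewrite mr.
move=> S [[Sne _] SR]; have [->|S0] := pselect (S = [set 0]); first by left.
right; have [s Ss s0] := nonzero_of S Sne S0.
apply/seteqP; split=> // t; rewrite (orbitT s s0) => -[r _ <-].
exact: SR.
Qed.
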